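(* Let $r,R$ be integers with $1\le r<R$. For three sequences $\{f_n\}_{n\ge 0}$ (with $f_0=1$), $\{g_n\}_{n=1}^R$ and $\{h_n\}_{n=1}^R$, put $H_j=h_1\cdots h_j$ and $G_j=g_1\cdots g_j$. Then the following statements are equivalent. (i) $$\sum_{n=0}^\infty f_n x^n=\left(1+\sum_{j=r}^R\frac{h_1\cdots h_j}{g_1\cdots g_j}x^j\right)^{-1}=\left(1+\sum_{j=r}^R\frac{H_j}{G_j}x^j\right)^{-1}$$ $$=1-\cfrac{h_1\cdots h_r x^r}{g_1\cdots g_r+h_1\cdots h_r x^r-\cfrac{g_1\cdots g_r h_{r+1}x}{g_{r+1}+h_{r+1}x-\cfrac{g_{r+1}h_{r+2}x}{g_{r+2}+h_{r+2}x-\cdots-\cfrac{g_{R-1}h_R x}{g_R+h_R x}}}}.$$ (ii) For $n\ge r$, $f_n=(-1)^n\det(a_{i,j})_{1\le i,j\le n}$, where $a_{i,j}=\frac{H_{i-j+1}}{G_{i-j+1}}$ if $r\le i-j+1\le R$, $a_{i,j}=1$ if $j=i+1$, and $a_{i,j}=0$ otherwise. (iii) $$\sum_{k=\max(0,n-R)}^{n-r}\frac{f_kH_{n-k}}{G_{n-k}}=\begin{cases}1&\text{if } n=0,\\ 0&\text{if } n\ge 1.\end{cases}$$ (iv) For $n\ge1$, $$(-1)^n\begin{vmatrix} f_1&1&0&&\\ f_2&f_1&1&&\\ \vdots&\vdots&\ddots&&0\\ f_{n-1}&f_{n-2}&\cdots&f_1&1\\ f_n&f_{n-1}&\cdots&f_2&f_1\end{vmatrix}=\begin{cases}\frac{H_n}{G_n}&\text{if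 } r\le n\le R,\\ 0&\text{otherwise.}\end{cases}$$ (v) For $n\ge 1$, $$f_n=\sum_{rt_r+(r+1)t_{r+1}+\cdots+Rt_R=n}\binom{t_r+\cdots+t_R}{t_r,\dots,t_R}(-1)^{t_r+\cdots+t_R}\left(\frac{H_r}{G_r}\right)^{t_r}\left(\frac{H_{r+1}}{G_{r+1}}\right)^{t_{r+1}}\cdots\left(\frac{H_R}{G_R}\right)^{t_R}$$ $$=\sum_{k=1}^n(-1)^k\sum_{\substack{i_1+\cdots+i_k=n\\ r\le i_1,\dots,i_k\le R}}\frac{H_{i_1}}{G_{i_1}}\cdots\frac{H_{i_k}}{G_{i_k}}.$$ (vi) For $n\ge1$, $$\sum_{t_1+2t_2+\cdots+nt_n=n}\binom{t_1+\cdots+t_n}{t_1,\dots,t_n}(-1)^{t_1+\cdots+t_n}f_1^{t_1}f_2^{t_2}\cdots f_n^{t_n}=\sum_{k=1}^n(-1)^k\sum_{\substack{i_1+\cdots+i_k=n\\ i_1,\dots,i_k\ge 1}}f_{i_1}\cdots f_{i_k}=\begin{cases}\frac{H_n}{G_n}&\text{if } r\le n\le R,\\ 0&\text{otherwise.}\end{cases}$$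
   Context: The $g_n$ are taken nonzero, so that the quotients $H_j/G_j$ are defined. The identities in (i) are read as identities of power series in $x$. The $t_i$ are nonnegative integers, the $i_j$ are integers, and $\binom{t_a+\cdots+t_b}{t_a,\dots,t_b}=\frac{(t_a+\cdots+t_b)!}{t_a!\cdots t_b!}$ is the multinomial coefficient. The $n\times n$ determinant in (iv) has $(i,j)$ entry $f_{i-j+1}$ if $i\ge j$, $1$ if $j=i+1$, and $0$ if $j>i+1$.
   Formalization: Statement (ii) is required for all n ≥ 1 rather than only n ≥ r (as printed it leaves f_1,…,f_{r-1} free), and the left side of (iii) has the missing term f_n added (as printed the sum is empty at n = 0, so (iii) could never hold). *)

(* Defs.v *)
From HB Require Import structures.
From mathcomp Require Import all_boot all_order all_algebra.
From mathcomp Require Import boolp.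
Set Implicit Arguments.
Unset Strict Implicit.
Unset Printing Implicit Defensive.
Import GRing.Theory.
Local Open Scope ring_scope.

(* Formal power series in one indeterminate; equality is decided classically. *)
Record fps (K : Type) := FPS { coefs : nat -> K }.

Section ClassicalStructure.
Variable K : Type.
HB.instance Definition _ := gen_eqMixin (fps K).
HB.instance Definition _ := gen_choiceMixin (fps K).
End ClassicalStructure.

Lemma fpsP (K : Type) (p q : fps K) :
  (forall n, coefs p n = coefs q n) <-> p = q.
Proof.
split=> [|-> //]; case: p q => [p] [q] /= pq; congr FPS; exact: funext.
Qed.

Section Ring.
Variable K : comNzRingType.
Implicit Types (p q : fps K) (c : K) (n : nat).

Definition fpsC c : fps K := FPS (fun n => if n == 0%N then c else 0).
Definition fpsX : fps K := FPS (fun n => (n == 1%N)%:R).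
Definition fps_add p q : fps K := FPS (fun n => coefs p n + coefs q n).
Definition fps_opp p : fps K := FPS (fun n => - coefs p n).
Definition fps_mul p q : fps K :=
  FPS (fun n => \sum_(k < n.+1) coefs p k * coefs q (n - k)).

Fact fps_addA : associative fps_add.
Proof. by move=> p q s; apply/fpsP => n /=; rewrite addrA. Qed.
Fact fps_addC : commutative fps_add.
Proof. by move=> p q; apply/fpsP => n /=; rewrite addrC. Qed.
Fact fps_add0 : left_id (fpsC 0) fps_add.
Proof. by move=> p; apply/fpsP => n /=; rewrite if_same add0r. Qed.
Fact fps_addN : left_inverse (fpsC 0) fps_opp fps_add.
Proof. by move=> p; apply/fpsP => n /=; rewrite if_same addNr. Qed.

HB.instance Definition _ :=
  GRing.isZmodule.Build (fps K) fps_addA fps_addC fps_add0 fps_addN.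

Let trunc p n : {poly K} := \poly_(i < n.+1) coefs p i.

Let truncE p n i : (i <= n)%N -> (trunc p n)`_i = coefs p i.
Proof. by move=> le_in; rewrite coef_poly ltnS le_in. Qed.

Let trunc_mul p q n i : (i <= n)%N ->
  (trunc p n * trunc q n)`_i = coefs (fps_mul p q) i.
Proof.
move=> le_in; rewrite coefM; apply: eq_bigr => k _.
by rewrite !truncE // (leq_trans _ le_in) ?leq_subr // -ltnS.
Qed.

Fact fps_mulC : commutative fps_mul.
Proof.
by move=> p q; apply/fpsP => n; rewrite -!(@trunc_mul _ _ n) // mulrC.
Qed.

Fact fps_mulA : associative fps_mul.
Proof.
move=> p q s; apply/fpsP => n.
transitivity ((trunc p n * (trunc q n * trunc s n))`_n).
  rewrite coefM; apply: eq_bigr => k _.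
  by rewrite trunc_mul ?leq_subr // truncE // -ltnS.
rewrite mulrA coefM; apply: eq_bigr => k _.
by rewrite trunc_mul 1?truncE ?leq_subr // -ltnS.
Qed.

Fact fps_mul1 : left_id (fpsC 1) fps_mul.
Proof.
move=> p; apply/fpsP => n /=; rewrite big_ord_recl /= subn0 mul1r.
by rewrite big1 ?addr0 // => i _; rewrite mul0r.
Qed.

Fact fps_mulDl : left_distributive fps_mul fps_add.
Proof.
move=> p q s; apply/fpsP => n /=; rewrite -big_split /=.
by apply: eq_bigr => i _; rewrite mulrDl.
Qed.

Fact fps_oner_neq0 : fpsC 1 != fpsC 0.
Proof. by apply/eqP => /fpsP /(_ 0%N) /= /eqP; rewrite oner_eq0. Qed.

HB.instance Definition _ := GRing.Zmodule_isComNzRing.Build (fps K)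
  fps_mulA fps_mulC fps_mul1 fps_mulDl fps_oner_neq0.

End Ring.

Arguments fpsX {K}.

Section UnitRing.
Variable K : comUnitRingType.
Implicit Types (p q : fps K) (n : nat).

Definition fps_unit : pred (fps K) := fun p => coefs p 0%N \is a GRing.unit.

(* The first n coefficients b_0, b_1, ... of 1 / p, from the recurrence
   p_0 b_m = - \sum_(k < m) p_(m - k) b_k for m > 0. *)
Fixpoint fps_inv_seq p n : seq K :=
  if n is m.+1 then
    let s := fps_inv_seq p m in
    rcons s ((coefs p 0%N)^-1 *
             ((m == 0%N)%:R - \sum_(k < m) coefs p (m - k) * s`_k))
  else [::].

Definition fps_inv p : fps K :=
  if fps_unit p then FPS (fun n => (fps_inv_seq p n.+1)`_n) else p.

Let size_inv_seq p n : size (fps_inv_seq p n) = n.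
Proof. by elim: n => //= n IHn; rewrite size_rcons IHn. Qed.

Let nth_inv_seq p n k : (k < n)%N ->
  (fps_inv_seq p n)`_k = (fps_inv_seq p k.+1)`_k.
Proof.
elim: n => // n IHn; rewrite ltnS leq_eqVlt => /predU1P[-> //|lt_kn].
by rewrite /= nth_rcons size_inv_seq lt_kn IHn.
Qed.

Fact fps_mulVr : {in fps_unit, left_inverse 1 fps_inv *%R}.
Proof.
move=> p Up; have {}Up : fps_unit p := Up; rewrite mulrC; apply/fpsP => n.
rewrite /fps_inv Up /= big_ord_recl subn0 /=.
rewrite nth_rcons size_inv_seq ltnn eqxx mulVKr //.
rewrite (reindex_inj rev_ord_inj) /=.
set A := \sum_(k < n) _; set B := \sum_(i < n) _.
suff -> : B = A by rewrite subrK; case: (n == 0%N).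
apply: eq_bigr => k _; rewrite subKn // [in RHS]nth_inv_seq //.
by rewrite ltn_subrL (leq_ltn_trans _ (ltn_ord k)).
Qed.

Fact fps_unitPl p q : q * p = 1 -> fps_unit p.
Proof.
move=> /fpsP /(_ 0%N); rewrite /= big_ord1 subnn => qp1.
by apply/unitrPr; exists (coefs q 0%N); rewrite mulrC.
Qed.

Fact fps_inv_out : {in [predC fps_unit], fps_inv =1 id}.
Proof. by move=> p /negPf Up; rewrite /fps_inv [fps_unit p]Up. Qed.

HB.instance Definition _ := GRing.ComNzRing_hasMulInverse.Build (fps K)
  fps_mulVr fps_unitPl fps_inv_out.

End UnitRing.

Section Fractions.
Variable F : fieldType.
Implicit Types (g h : nat -> F) (r R : nat).

(* Finite sequences indexed from 1 are represented by functions on nat whose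
   other values are never used. *)
Definition pprod (u : nat -> F) (j : nat) : F := \prod_(1 <= i < j.+1) u i.

Definition HGratio h g (j : nat) : F := pprod h j / pprod g j.

(* g_j + h_j x - g_j h_(j+1) x / (g_(j+1) + h_(j+1) x - ...), continued down to
   the index j + m. *)
Fixpoint cf_tail h g (j m : nat) : fps F :=
  fpsC (g j) + fpsC (h j) * fpsX -
  (if m is m'.+1 then fpsC (g j * h j.+1) * fpsX / cf_tail h g j.+1 m' else 0).

(* All the denominators have a constant term that is a product of g_j's, so
   they are units when the g_j's are nonzero. *)
Definition cfrac h g r R : fps F :=
  1 - fpsC (pprod h r) * fpsX ^+ r /
      (fpsC (pprod g r) + fpsC (pprod h r) * fpsX ^+ r -
       fpsC (pprod g r * h r.+1) * fpsX / cf_tail h g r.+1 (R - r.+1)).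

End Fractions.

Section Expansions.
Variable F : fieldType.
Implicit Types (c : nat -> F) (a b n : nat).

Definition multinomial (m : nat) (t : 'I_m -> nat) : nat :=
  ((\sum_(i < m) t i)`! %/ \prod_(i < m) (t i)`!)%N.

(* The sum over all (t_a, ..., t_b) with a t_a + ... + b t_b = n, where t i
   stands for t_(a+i); since a > 0 in all uses, each t_j is at most n. *)
Definition multinomial_sum c a b n : F :=
  \sum_(t : {ffun 'I_(b.+1 - a) -> 'I_n.+1} |
       (\sum_(i < b.+1 - a) (a + i) * t i == n)%N)
    (multinomial (fun i => t i : nat))%:R *
    (-1) ^+ (\sum_(i < b.+1 - a) t i)%N *
    \prod_(i < b.+1 - a) c (a + i)%N ^+ t i.

(* The inner sum is over all (i_1, ..., i_k) with i_1 + ... + i_k = n and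
   a <= i_l <= b. *)
Definition composition_sum c a b n : F :=
  \sum_(1 <= k < n.+1) (-1) ^+ k *
    \sum_(i : {ffun 'I_k -> 'I_b.+1} |
          [forall l, (a <= i l)%N] && (\sum_(l < k) i l == n)%N)
      \prod_(l < k) c (i l).

End Expansions.

(* Main.v *)
Require Import Defs.
From HB Require Import structures.
From mathcomp Require Import all_boot all_order all_algebra.
From mathcomp Require Import boolp.
Import GRing.Theory.
Local Open Scope ring_scope.

(** Put A = 1 + sum_(r <= j <= R) (H_j / G_j) x^j and let f also denote the
    generating series of the f_n.  Both series have constant term 1, and each
    of the six statements says in its own way that f and A are inverse to each
    other: (i), (ii), (iii) and (v) give the coefficients of f as those of 1/A
    (or say f A = 1), while (iv) and (vi) give the coefficients of A as those
    of 1/f.  This leaves the continued fraction of (i), and two formulas for the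
    coefficients of 1/p, where p is any series with constant term 1.

    The determinants: multiplication by p modulo x^(n+1) is a unitriangular
    Toeplitz matrix T, and the coefficient of x^n in 1/p is the bottom left
    entry of the inverse of T.  As det T = 1, this entry is a cofactor, whose
    minor is the Hessenberg matrix of (ii) and (iv) (coefs_inv_det).  In
    particular it depends only on the first coefficients of p.

    The sums: writing p = 1 + u, the geometric series 1/p = sum_k (-u)^k is
    finite in each degree (coefs_inv_geometric).  Expanding u^k by
    distributivity gives the sum over compositions, and expanding it by the
    multinomial theorem gives the sum over multiplicities
    (composition_sum_powers, multinomial_sum_powers), so that the two sums are
    equal term by term in k.

    The continued fraction is Euler's: put S_(R+1) = 1 and
    S_j = 1 + (h_j / g_j) x S_(j+1), so that A = 1 + (H_r / G_r) x^r S_(r+1).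
    Then the tail starting at g_j + h_j x is g_j S_j / S_(j+1) (cf_tail_nested_sum),
    and the fraction collapses to 1/A (inv_sum_cfrac). *)

(** * Coefficients of power series *)

Lemma coefs_sum {K : comNzRingType} {I : Type} (s : seq I) (P : pred I)
    (F : I -> fps K) n :
  coefs (\sum_(i <- s | P i) F i) n = \sum_(i <- s | P i) coefs (F i) n.
Proof. by apply: (big_morph (fun p => coefs p n)) => //=; rewrite if_same. Qed.

Lemma coefsD {K : comNzRingType} (p q : fps K) n :
  coefs (p + q) n = coefs p n + coefs q n.
Proof. by []. Qed.

Lemma coefsM {K : comNzRingType} (p q : fps K) n :
  coefs (p * q) n = \sum_(k < n.+1) coefs p k * coefs q (n - k).
Proof. by []. Qed.

Lemma coefs1 {K : comNzRingType} n : coefs (1 : fps K) n = (n == 0%N)%:R.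
Proof. by case: n. Qed.

Lemma coefsCM {K : comNzRingType} (c : K) p n :
  coefs (fpsC c * p) n = c * coefs p n.
Proof.
rewrite /= big_ord_recl /= subn0 big1 ?addr0 // => i _.
by rewrite mul0r.
Qed.

Lemma coefsXM {K : comNzRingType} (p : fps K) n :
  coefs (fpsX * p) n = if n is m.+1 then coefs p m else 0.
Proof.
case: n => [|n] /=; first by rewrite big_ord1 mul0r.
rewrite 2!big_ord_recl /= mul0r add0r mul1r subSS subn0 big1 ?addr0 // => i _.
by rewrite mul0r.
Qed.

Lemma coefsCXn {K : comNzRingType} (c : K) j n :
  coefs (fpsC c * fpsX ^+ j) n = c *+ (n == j).
Proof.
rewrite coefsCM -mulr_natr; congr (_ * _).
by elim: j n => [|j IHj] n; rewrite ?coefs1 // exprS coefsXM; case: n.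
Qed.

Lemma coefs_signM {K : comNzRingType} (p : fps K) k n :
  coefs ((-1) ^+ k * p) n = (-1) ^+ k * coefs p n.
Proof. by rewrite -!(signr_odd _ k); case: (odd k); rewrite ?mulN1r ?mul1r. Qed.

Lemma fpsCM {K : comNzRingType} (c d : K) : fpsC (c * d) = fpsC c * fpsC d.
Proof.
by apply/fpsP => n; rewrite coefsCM /=; case: (n == 0%N); rewrite ?mulr0.
Qed.

Lemma fpsC1 {K : comNzRingType} : fpsC (1 : K) = 1.
Proof. by []. Qed.

Lemma fpsCX {K : comNzRingType} (c : K) n : fpsC (c ^+ n) = fpsC c ^+ n.
Proof. by elim: n => // n IHn; rewrite !exprS fpsCM IHn. Qed.

Lemma fpsC_nat {K : comNzRingType} n : n%:R = fpsC (n%:R : K).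
Proof.
elim: n => [|n IHn]; first by [].
by rewrite !mulrS IHn; apply/fpsP => i /=; case: (i == 0%N); rewrite ?addr0.
Qed.

Lemma coefs_monomial_sum {K : comNzRingType} (c : nat -> K) a b n :
  coefs (\sum_(a <= j < b.+1) fpsC (c j) * fpsX ^+ j) n =
  if (a <= n <= b)%N then c n else 0.
Proof.
rewrite coefs_sum; under eq_bigr => j _ do rewrite coefsCXn mulrb.
rewrite -big_mkcond (eq_bigl (fun j => j == n)) => [|j]; last exact: eq_sym.
by rewrite big_nat1_eq ltnS.
Qed.

Lemma prod_monomials {K : comNzRingType} {I : Type} (s : seq I) (c : I -> K)
    (e : I -> nat) :
  \prod_(i <- s) (fpsC (c i) * fpsX ^+ e i) =
  fpsC (\prod_(i <- s) c i) * fpsX ^+ (\sum_(i <- s) e i)%N.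
Proof.
elim: s => [|i s IHs]; first by rewrite !big_nil fpsC1 mulr1.
by rewrite !big_cons IHs fpsCM exprD mulrACA.
Qed.

(** * The coefficients of an inverse series *)

Lemma coefs_expM_lt {K : comNzRingType} (u q : fps K) k n :
  coefs u 0 = 0 -> (n < k)%N -> coefs (u ^+ k * q) n = 0.
Proof.
move=> u0; elim: k n => // k IHk n lt_nk; rewrite exprS -mulrA /=.
rewrite big_ord_recl u0 mul0r add0r big1 // => i _ /=.
rewrite [X in _ * X]IHk ?mulr0 // /bump leq0n add1n.
case: n lt_nk i => [|n] lt_nk [i lt_in] //=.
by rewrite subSS (leq_ltn_trans (leq_subr _ _)).
Qed.

(** The geometric series of 1 - p, cut after n + 1 terms: the remainder is a
    multiple of (1 - p)^(n+1), which has order greater than n. *)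
Lemma coefs_inv_geometric {K : comUnitRingType} (p : fps K) n :
  coefs p 0 = 1 ->
  coefs p^-1 n = \sum_(k < n.+1) (-1) ^+ k * coefs ((p - 1) ^+ k) n.
Proof.
move=> p0; have Up : p \is a GRing.unit.
  by rewrite unfold_in /= /fps_unit p0 unitr1.
have -> : p^-1 = \sum_(k < n.+1) (- (p - 1)) ^+ k
                 + (- (p - 1)) ^+ n.+1 * p^-1.
  apply: (mulrI Up); rewrite mulrV // mulrDr mulrCA mulrV // mulr1.
  have := subrX1 (- (p - 1)) n.+1; set v := - (p - 1).
  have -> : v - 1 = - p by rewrite /v opprB addrC addrA addNr add0r.
  by rewrite mulNr => /eqP; rewrite subr_eq => /eqP ->; rewrite addNKr.
rewrite [LHS]coefsD [X in _ + X]coefs_expM_lt //; last first.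
  by rewrite /= p0 subrr oppr0.
rewrite addr0 coefs_sum; apply: eq_bigr => k _.
by rewrite [in LHS]exprNn coefs_signM.
Qed.

(** Cramer's rule for the Toeplitz matrix of p: the coefficients of 1/p solve a
    unitriangular system with right-hand side e_0, so the last one is a
    cofactor; deleting the first row and the last column of the Toeplitz matrix
    moves its diagonal of ones to the superdiagonal. *)
Lemma coefs_inv_det {K : comUnitRingType} (p : fps K) n : coefs p 0 = 1 ->
  coefs p^-1 n = (-1) ^+ n *
    \det (\matrix_(i < n, j < n)
      if (j <= i.+1)%N then coefs p (i.+1 - j) else 0).
Proof.
move=> p0; have Up : p \is a GRing.unit.
  by rewrite unfold_in /= /fps_unit p0 unitr1.
pose T : 'M[K]_n.+1 := \matrix_(i, j) if (j <= i)%N then coefs p (i - j) else 0.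
pose v : 'cV[K]_n.+1 := \col_i coefs p^-1 i.
have detT : \det T = 1.
  rewrite det_trig; last first.
    by apply/is_trig_mxP => i j; rewrite mxE ltnNge => /negPf ->.
  by rewrite big1 // => i _; rewrite mxE leqnn subnn.
have Tv : T *m v = delta_mx 0 0.
  apply/matrixP => i j; rewrite !mxE ord1 andbT -coefs1 -(mulVr Up) /=.
  rewrite (big_ord_widen n.+1 (fun k => coefs p^-1 k * coefs p (i - k))) //.
  rewrite [RHS]big_mkcond; apply: eq_bigr => k _; rewrite !mxE ltnS.
  by case: leqP; rewrite ?mul0r // mulrC.
have -> : coefs p^-1 n = v ord_max 0 by rewrite mxE.
have -> : v = \adj T *m delta_mx 0 0.
  by rewrite -Tv mulmxA mul_adj_mx detT mul1mx.
rewrite mxE (bigD1 0) //= big1 => [|k nz].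
  rewrite addr0 !mxE mulr1 /cofactor add0n; congr (_ * \det _).
  by apply/matrixP => i j; rewrite !mxE lift_max lift0.
by rewrite !mxE (negPf nz) mulr0.
Qed.

(** Lets an infinite series be replaced by a polynomial truncation before its
    inverse is expanded. *)
Lemma eq_coefs_inv {K : comUnitRingType} (p q : fps K) n : coefs p 0 = 1 ->
  (forall i, (i <= n)%N -> coefs p i = coefs q i) ->
  coefs p^-1 n = coefs q^-1 n.
Proof.
move=> p0 eq_pq; rewrite !coefs_inv_det -?eq_pq //; congr (_ * \det _).
apply/matrixP => i j; rewrite !mxE; case: ifP => // _; apply: eq_pq.
exact: leq_trans (leq_subr _ _) _.
Qed.

(** * The multinomial theorem *)

Definition ffun_cons {T : Type} {m} (x : T) (s : {ffun 'I_m -> T}) :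
    {ffun 'I_m.+1 -> T} :=
  [ffun i => if unlift ord0 i is Some j then s j else x].

Lemma ffun_cons0 {T : Type} {m} (x : T) (s : {ffun 'I_m -> T}) :
  ffun_cons x s ord0 = x.
Proof. by rewrite ffunE unlift_none. Qed.

Lemma ffun_cons_lift {T : Type} {m} (x : T) (s : {ffun 'I_m -> T}) j :
  ffun_cons x s (lift ord0 j) = s j.
Proof. by rewrite ffunE liftK. Qed.

(** Splits off the first exponent of a tuple of exponents, for inductions on the
    number of variables. *)
Lemma big_ffun_cons {V : nmodType} {T : finType} m
    (P : pred {ffun 'I_m.+1 -> T}) (E : {ffun 'I_m.+1 -> T} -> V) :
  \sum_(t | P t) E t =
  \sum_(x : T) \sum_(s : {ffun 'I_m -> T} | P (ffun_cons x s))
    E (ffun_cons x s).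
Proof.
rewrite pair_big_dep /= (reindex (fun p => ffun_cons p.1 p.2)) //=.
exists (fun t : {ffun _} => (t ord0, [ffun j => t (lift ord0 j)])).
  move=> [x s] _; congr (_, _); first exact: ffun_cons0.
  by apply/ffunP => j; rewrite ffunE ffun_cons_lift.
move=> t _; apply/ffunP => i.
have [j|] := unliftP ord0 i => ->; last by rewrite ffun_cons0.
by rewrite ffun_cons_lift ffunE.
Qed.

Lemma dvdn_prod_fact m (t : 'I_m -> nat) :
  (\prod_(i < m) (t i)`! %| (\sum_(i < m) t i)`!)%N.
Proof.
elim: m t => [|m IHm] t; first by rewrite !big_ord0.
rewrite !big_ord_recl -(bin_fact (leq_addr _ (t ord0))) addKn dvdn_mull //.
by rewrite dvdn_mul.
Qed.

(** The recursion by which the multinomial theorem follows from the binomial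
    one. *)
Lemma multinomialS m (t : 'I_m.+1 -> nat) :
  multinomial t =
  ('C(\sum_(i < m.+1) t i, t ord0) * multinomial (fun j => t (lift ord0 j)))%N.
Proof.
rewrite /multinomial muln_divA ?dvdn_prod_fact // !big_ord_recl.
rewrite -(bin_fact (leq_addr _ (t ord0))) addKn mulnCA divnMl //.
exact: fact_gt0.
Qed.

(** The exponents range over 'I_N.+1 with N independent of k, so that the
    expansions of all the powers up to N have the same index type and can be
    added up. *)
Lemma multinomial_theorem {K : comNzRingType} m N k (x : 'I_m -> K) :
  (k <= N)%N ->
  (\sum_(i < m) x i) ^+ k =
  \sum_(t : {ffun 'I_m -> 'I_N.+1} | (\sum_(i < m) t i == k)%N)
    (multinomial (fun i => t i : nat))%:R * \prod_(i < m) x i ^+ t i.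
Proof.
elim: m k x => [|m IHm] k x le_kN.
  rewrite big_ord0 expr0n.
  under eq_bigl => t do rewrite big_ord0 eq_sym.
  case: eqP => _; last by rewrite big_pred0_eq.
  under eq_bigr => t _ do rewrite /multinomial !big_ord0 divn1 mulr1.
  by rewrite sumr_const card_ffun !card_ord.
rewrite big_ord_recl addrC exprDn.
rewrite (big_ord_widen N.+1 (fun i => (\sum_(j < m) x (lift ord0 j)) ^+ (k - i)
                                       * x ord0 ^+ i *+ 'C(k, i))) //.
rewrite big_ffun_cons big_mkcond; apply: eq_bigr => i _ /=; rewrite ltnS.
have sum_cons (s : {ffun 'I_m -> 'I_N.+1}) :
    (\sum_(j < m.+1) ffun_cons i s j = i + \sum_(j < m) s j)%N.
  rewrite big_ord_recl ffun_cons0; congr (_ + _)%N.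
  by apply: eq_bigr => j _; rewrite ffun_cons_lift.
under [RHS]eq_bigl => s do rewrite sum_cons.
case: leqP => [le_ik|lt_ki]; last first.
  by rewrite big_pred0 // => s; rewrite gtn_eqF // (leq_trans lt_ki) ?leq_addr.
rewrite IHm ?(leq_trans (leq_subr _ _)) // mulr_suml -sumrMnl.
apply: eq_big => s; first by rewrite -(eqn_add2l i) subnKC.
move=> /eqP sum_s; rewrite multinomialS sum_cons sum_s subnKC // ffun_cons0.
rewrite big_ord_recl ffun_cons0 natrM -[LHS]mulr_natl -!mulrA; congr (_ * _).
rewrite [_ * x ord0 ^+ i]mulrC; congr (_ * (_ * _)); last first.
  by apply: eq_bigr => j _; rewrite ffun_cons_lift.
by congr (multinomial _)%:R; apply: funext => j; rewrite ffun_cons_lift.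
Qed.

(** * Sums over compositions and over multiplicities *)

Lemma composition_sum_powers {F : fieldType} (c : nat -> F) a b n :
  composition_sum c a b n =
  \sum_(1 <= k < n.+1)
    (-1) ^+ k * coefs ((\sum_(a <= j < b.+1) fpsC (c j) * fpsX ^+ j) ^+ k) n.
Proof.
apply: eq_bigr => k _; congr (_ * _).
rewrite (big_nat_widenl _ 0) // big_mkord -[k in _ ^+ k]card_ord -prodr_const.
rewrite bigA_distr_big coefs_sum big_mkcondr /=; apply: eq_big => i.
  by apply/forallP/ffun_onP.
by rewrite prod_monomials coefsCXn eq_sym mulrb.
Qed.

(** In a tuple t of multiplicities with sum_i (a + i) t_i = n, the number of
    parts k = sum_i t_i lies between 1 and n because a > 0 and n > 0; grouping
    the tuples by k gives the multinomial expansions of the k-th powers. *)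
Lemma multinomial_sum_powers {F : fieldType} (c : nat -> F) a b n :
  (0 < a)%N -> (0 < n)%N ->
  multinomial_sum c a b n =
  \sum_(1 <= k < n.+1)
    (-1) ^+ k * coefs ((\sum_(a <= j < b.+1) fpsC (c j) * fpsX ^+ j) ^+ k) n.
Proof.
move=> a_gt0 n_gt0.
pose wt (t : {ffun 'I_(b.+1 - a) -> 'I_n.+1}) :=
  (\sum_(i < b.+1 - a) (a + i) * t i)%N.
pose len (t : {ffun 'I_(b.+1 - a) -> 'I_n.+1}) := (\sum_(i < b.+1 - a) t i)%N.
have le_len t : (len t <= wt t)%N.
  by apply: leq_sum => i _; rewrite leq_pmull ?addn_gt0 ?a_gt0.
have coef_pow k : (k <= n)%N ->
    coefs ((\sum_(a <= j < b.+1) fpsC (c j) * fpsX ^+ j) ^+ k) n =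
    \sum_(t | (wt t == n) && (len t == k))
      (multinomial (fun i => t i : nat))%:R *
      \prod_(i < b.+1 - a) c (a + i)%N ^+ t i.
  move=> le_kn; rewrite -{1}[a]add0n big_addn big_mkord.
  rewrite (@multinomial_theorem _ _ n) // coefs_sum.
  rewrite [RHS]big_mkcondl; apply: eq_bigr => t _.
  under [X in coefs (_ * X)]eq_bigr => i _
    do rewrite exprMn -fpsCX -exprM [(i + a)%N]addnC.
  rewrite prod_monomials fpsC_nat coefsCM coefsCXn eq_sym -/(wt t).
  by case: eqP; rewrite ?mulr0.
rewrite [RHS](big_nat_widenl _ 0) // big_mkord.
rewrite /multinomial_sum.
rewrite (partition_big (fun t => inord (len t)) (fun k : 'I_n.+1 => 0 < k)%N).
  apply: eq_bigr => k _; rewrite coef_pow -1?ltnS // mulr_sumr.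
  have len_eq t : wt t == n -> (inord (len t) == k) = (len t == k).
    by move=> /eqP wt_t; rewrite -val_eqE /= inordK // ltnS -wt_t.
  apply: eq_big => t.
    by rewrite -/(wt t); case: (boolP (wt t == n)) => // /len_eq.
  case/andP=> wt_t; rewrite len_eq // -/(len t) => /eqP ->.
  by rewrite mulrAC [RHS]mulrC.
move=> t /eqP wt_t; rewrite inordK ?ltnS -?wt_t //.
rewrite lt0n; apply: contraTneq n_gt0 => len0.
rewrite -wt_t -leqNgt leqn0 sum_nat_eq0; apply/forallP => i; apply/implyP => _.
move: len0 => /eqP; rewrite sum_nat_eq0 => /forallP/(_ i) /eqP ->.
by rewrite muln0.
Qed.

(** Only the coefficients of p up to degree n are constrained, which covers both
    p = A and, with a = 1 and b = n, an arbitrary series. *)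
Lemma coefs_inv_composition {F : fieldType} (c : nat -> F) a b n (p : fps F) :
  (0 < a)%N -> (0 < n)%N -> coefs p 0 = 1 ->
  (forall i, (0 < i <= n)%N ->
     coefs p i = if (a <= i <= b)%N then c i else 0) ->
  composition_sum c a b n = coefs p^-1 n.
Proof.
move=> a_gt0 n_gt0 p0 coef_p; rewrite composition_sum_powers.
set u := \sum_(a <= j < b.+1) _.
have coef_u i : coefs u i = if (a <= i <= b)%N then c i else 0.
  exact: coefs_monomial_sum.
have u0 : coefs u 0 = 0 by rewrite coef_u leqNgt a_gt0.
have p1u0 : coefs (1 + u) 0 = 1 by rewrite coefsD coefs1 u0 addr0.
rewrite -[RHS](@eq_coefs_inv _ (1 + u)) // => [|[|i] le_in]; last first.
- by rewrite coefsD coefs1 add0r coef_u coef_p.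
- by rewrite p1u0.
rewrite coefs_inv_geometric // -(big_mkord xpredT (fun k =>
  (-1) ^+ k * coefs ((1 + u - 1) ^+ k) n)) [1 + u]addrC addrK.
rewrite [RHS]big_ltn // expr0 expr0 coefs1 mul1r.
by rewrite eqn0Ngt n_gt0 add0r.
Qed.

Lemma multinomial_sum_composition {F : fieldType} (c : nat -> F) a b n :
  (0 < a)%N -> (0 < n)%N -> multinomial_sum c a b n = composition_sum c a b n.
Proof.
by move=> a_gt0 n_gt0; rewrite multinomial_sum_powers // composition_sum_powers.
Qed.

(** * Euler's continued fraction *)

(** The finite sum 1 + (h_j / g_j) x + (h_j h_(j+1)) / (g_j g_(j+1)) x^2 + ...
    with m + 1 terms, in Horner form: a level of nesting corresponds to a level
    of the continued fraction. *)
Fixpoint nested_sum {F : fieldType} (h g : nat -> F) j m : fps F :=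
  if m is m'.+1 then
    1 + fpsC (h j / g j) * fpsX * nested_sum h g j.+1 m'
  else 1.

Lemma nested_sumS {F : fieldType} (h g : nat -> F) j m :
  nested_sum h g j m.+1 = 1 + fpsC (h j / g j) * fpsX * nested_sum h g j.+1 m.
Proof. by []. Qed.

Lemma coefs_nested_sum0 {F : fieldType} (h g : nat -> F) j m :
  coefs (nested_sum h g j m) 0 = 1.
Proof.
case: m => [|m]; first by [].
by rewrite nested_sumS coefsD coefs1 -mulrA coefsCM coefsXM mulr0 addr0.
Qed.

Lemma unit_fps {F : fieldType} (p : fps F) :
  (p \is a GRing.unit) = (coefs p 0 != 0).
Proof. by rewrite -unitfE. Qed.

Lemma unit_nested_sum {F : fieldType} (h g : nat -> F) j m :
  nested_sum h g j m \is a GRing.unit.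
Proof. by rewrite unit_fps coefs_nested_sum0 oner_eq0. Qed.

Lemma pprodS {F : fieldType} (u : nat -> F) j :
  pprod u j.+1 = pprod u j * u j.+1.
Proof. by rewrite /pprod big_nat_recr. Qed.

Lemma HGratio_nested_sum {F : fieldType} (h g : nat -> F) r m :
  fpsC (HGratio h g r) * fpsX ^+ r * nested_sum h g r.+1 m =
  \sum_(r <= j < (r + m).+1) fpsC (HGratio h g j) * fpsX ^+ j.
Proof.
elim: m r => [|m IHm] r; first by rewrite addn0 big_nat1 mulr1.
rewrite big_ltn ?ltnS ?leq_addr // addnS -addSn -IHm /= mulrDr mulr1.
congr (_ + _); rewrite /HGratio !pprodS -mulf_div exprSr.
rewrite (fpsCM (_ / _)).
by rewrite -!mulrA; congr (_ * _); rewrite mulrCA.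
Qed.

(** One level of the fraction: x h_j S_(j+1) / (g_j S_j) is (S_j - 1) / S_j.
    The factor e stands for g_(j-1), which comes from the level above, or for
    the product g_1 ... g_r at the top level. *)
Lemma cf_tail_step {F : fieldType} (h g : nat -> F) j m (e : F) : g j != 0 ->
  cf_tail h g j m * nested_sum h g j.+1 m =
    fpsC (g j) * nested_sum h g j m.+1 ->
  fpsC (e * h j) * fpsX / cf_tail h g j m =
  fpsC e * (1 - (nested_sum h g j m.+1)^-1).
Proof.
move=> gj0 tail_eq.
have Utail : cf_tail h g j m \is a GRing.unit.
  suff : cf_tail h g j m * nested_sum h g j.+1 m \is a GRing.unit.
    by rewrite unitrM => /andP[].
  rewrite tail_eq unitrM unit_nested_sum andbT.
  by rewrite unit_fps.
apply: (mulIr Utail); rewrite divrK //.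
apply: (mulIr (unit_nested_sum h g j.+1 m)).
rewrite -!mulrA tail_eq [_ * (fpsC (g j) * _)]mulrCA mulrBl mul1r.
rewrite mulVr ?unit_nested_sum // nested_sumS.
rewrite [1 + _ - 1]addrAC subrr add0r !mulrA -!fpsCM.
by rewrite -[e * g j * _]mulrA [g j * _]mulrCA mulfV // mulr1.
Qed.

(** Invariant of the fraction: the tail at j is g_j S_j / S_(j+1), since by the
    previous step it equals g_j + h_j x - g_j (1 - 1 / S_(j+1)). *)
Lemma cf_tail_nested_sum {F : fieldType} (h g : nat -> F) j m :
  (forall i, (j <= i <= j + m)%N -> g i != 0) ->
  cf_tail h g j m * nested_sum h g j.+1 m =
  fpsC (g j) * nested_sum h g j m.+1.
Proof.
elim: m j => [|m IHm] j g_neq0.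
  rewrite /= subr0 !mulr1 mulrDr mulr1 mulrA -fpsCM mulrCA mulfV ?mulr1 //.
  by rewrite g_neq0 // leqnn leq_addr.
have gj0 : g j != 0 by rewrite g_neq0 // leqnn leq_addr.
rewrite [cf_tail _ _ _ _]/= cf_tail_step; last 2 first.
- by rewrite g_neq0 // leqnSn addnS ltnS leq_addr.
- apply: IHm => i /andP[lt_ji]; rewrite addSnnS => le_i.
  by rewrite g_neq0 // ltnW.
rewrite mulrBr mulr1 opprB [fpsC (g j) + _]addrC -addrA
  [fpsC (g j) + _]addrC subrK.
rewrite mulrDl divrK ?unit_nested_sum //.
rewrite [nested_sum h g j m.+2]nested_sumS [RHS]mulrDr mulr1 addrC.
by rewrite !mulrA -fpsCM [g j * _]mulrCA mulfV ?mulr1.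
Qed.

(** With S = S_(r+1), the top denominator is D = H_r x^r + G_r / S, that is
    G_r A / S, where A - 1 = (H_r / G_r) x^r S. *)
Lemma inv_sum_cfrac {F : fieldType} (h g : nat -> F) r R :
  (0 < r)%N -> (r < R)%N -> (forall i, (1 <= i <= R)%N -> g i != 0) ->
  (1 + \sum_(r <= j < R.+1) fpsC (HGratio h g j) * fpsX ^+ j)^-1 =
  cfrac h g r R.
Proof.
move=> r_gt0 lt_rR g_neq0.
have G_neq0 : pprod g r != 0.
  rewrite /pprod big_nat prodf_seq_neq0; apply/allP => i _ /=.
  apply/implyP; rewrite ltnS => /andP[i_gt0 le_ir].
  by rewrite g_neq0 // i_gt0 (leq_trans le_ir) ?(ltnW lt_rR).
have := HGratio_nested_sum h g r (R - r); rewrite subnKC ?(ltnW lt_rR) // => <-.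
have UA : 1 + fpsC (HGratio h g r) * fpsX ^+ r * nested_sum h g r.+1 (R - r)
    \is a GRing.unit.
  by rewrite unit_fps coefsD coefs1 -mulrA coefsCM -(prednK r_gt0) exprS -mulrA
    coefsXM mulr0 addr0 oner_eq0.
rewrite /cfrac cf_tail_step; last 2 first.
- by rewrite g_neq0.
- apply: cf_tail_nested_sum => i /andP[lt_ri].
  by rewrite subnKC // => le_iR; rewrite g_neq0 // le_iR (leq_trans _ lt_ri).
rewrite subnSK // mulrBr mulr1 opprB [fpsC (pprod g r) + _]addrC -addrA.
rewrite [fpsC (pprod g r) + _]addrC subrK.
set S := nested_sum _ _ _ _ in UA *; set HX := fpsC (pprod h r) * _.
have US : S \is a GRing.unit by exact: unit_nested_sum.
set A := 1 + _ in UA *; set D := (X in 1 - HX / X).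
have HXE : fpsC (pprod g r)^-1 * HX * S = A - 1.
  by rewrite /A addrAC subrr add0r mulrA -fpsCM mulrC [_^-1 * _]mulrC mulrC.
have DS : fpsC (pprod g r)^-1 * D * S = A.
  rewrite -mulrA mulrDl divrK // mulrDr mulrA HXE -fpsCM mulVf // fpsC1.
  by rewrite subrK.
have UD : D \is a GRing.unit.
  by move: UA; rewrite -DS !unitrM => /andP[/andP[]].
apply: (mulIr UA); rewrite mulVr // mulrBl mul1r.
suff -> : HX / D * A = A - 1 by rewrite subKr.
rewrite -HXE -DS [_ * D]mulrC -!mulrA mulKr //.
by rewrite [in LHS](mulrCA (fpsX ^+ r)) [LHS]mulrCA.
Qed.

(** * The six equivalent statements *)

Theorem theorem10 (F : fieldType) (r R : nat) (f g h : nat -> F)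
  (hr : (1 <= r)%N) (hrR : (r < R)%N) (hf0 : f 0%N = 1)
  (hg : forall n : nat, (1 <= n <= R)%N -> g n != 0) :
  [<->
   (* (i) *)
   FPS f = (1 + \sum_(r <= j < R.+1) fpsC (HGratio h g j) * fpsX ^+ j)^-1 /\
   (1 + \sum_(r <= j < R.+1) fpsC (HGratio h g j) * fpsX ^+ j)^-1
     = cfrac h g r R;
   (* (ii) *)
   forall n : nat, (1 <= n)%N ->
     f n = (-1) ^+ n *
       \det (\matrix_(i < n, j < n)
         (if (r <= i.+1 - j <= R)%N then HGratio h g (i.+1 - j)
          else if nat_of_ord j == i.+1 then 1 else 0));
   (* (iii) *)
   forall n : nat,
     f n + \sum_(n - R <= k < n.+1 - r) f k * pprod h (n - k) / pprod g (n - k)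
       = if n == 0%N then 1 else 0;
   (* (iv) *)
   forall n : nat, (1 <= n)%N ->
     (-1) ^+ n *
       \det (\matrix_(i < n, j < n)
         (if (j <= i)%N then f (i - j).+1
          else if nat_of_ord j == i.+1 then 1 else 0))
       = if (r <= n <= R)%N then HGratio h g n else 0;
   (* (v) *)
   forall n : nat, (1 <= n)%N ->
     f n = multinomial_sum (HGratio h g) r R n /\
     multinomial_sum (HGratio h g) r R n = composition_sum (HGratio h g) r R n;
   (* (vi) *)
   forall n : nat, (1 <= n)%N ->
     multinomial_sum f 1 n n = composition_sum f 1 n n /\
     composition_sum f 1 n n = if (r <= n <= R)%N then HGratio h g n else 0].
Proof.
rewrite -(inv_sum_cfrac h g r R hr hrR hg).
set A := 1 + _.
have coefA n : coefs A n =
    if n == 0%N then 1 else if (r <= n <= R)%N then HGratio h g n else 0.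
  rewrite coefsD coefs1 coefs_monomial_sum.
  by case: eqP => [->|_]; rewrite ?add0r // leqNgt hr addr0.
have A0 : coefs A 0 = 1 by rewrite coefA.
have UA : A \is a GRing.unit by rewrite unit_fps A0 oner_eq0.
(* Coefficient 0 of both sides is 1, so the coefficients of positive degree
   decide the equality. *)
have inv_coefs (P : nat -> Prop) :
    (forall n, (0 < n)%N -> P n <-> f n = coefs A^-1 n) ->
    ((forall n, (0 < n)%N -> P n) <-> FPS f = A^-1).
  move=> Pn; split=> [Pf|fA n n_gt0]; last by rewrite Pn // -fA.
  apply/fpsP => -[|n]; last exact/Pn/Pf.
  by rewrite coefs_inv_det // det_mx00 mulr1 /= hf0.
have inv_coefs' (P : nat -> Prop) :
    (forall n, (0 < n)%N -> P n <-> coefs (FPS f)^-1 n = coefs A n) ->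
    ((forall n, (0 < n)%N -> P n) <-> FPS f = A^-1).
  move=> Pn; split=> [Pf|fA n n_gt0]; last by rewrite Pn // fA invrK.
  rewrite -[FPS f]invrK; congr (_^-1); apply/fpsP => -[|n]; last exact/Pn/Pf.
  by rewrite coefs_inv_det // det_mx00 mulr1 A0.
have iE : FPS f = A^-1 /\ A^-1 = A^-1 <-> FPS f = A^-1 by split=> [[]|].
have iiE : (forall n, (0 < n)%N -> f n = (-1) ^+ n *
       \det (\matrix_(i < n, j < n)
         (if (r <= i.+1 - j <= R)%N then HGratio h g (i.+1 - j)
          else if nat_of_ord j == i.+1 then 1 else 0))) <-> FPS f = A^-1.
  apply: inv_coefs => n _; rewrite coefs_inv_det //.
  suff -> : \matrix_(i < n, j < n)
         (if (r <= i.+1 - j <= R)%N then HGratio h g (i.+1 - j)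
          else if nat_of_ord j == i.+1 then 1 else 0) =
     \matrix_(i < n, j < n)
         if (j <= i.+1)%N then coefs A (i.+1 - j) else 0 by [].
  apply/matrixP => i j; rewrite !mxE coefA subn_eq0.
  case: (ltngtP j i.+1) => [//|lt_ij|->]; last by rewrite subnn leqNgt hr.
  by rewrite (eqP (ltnW lt_ij)) leqNgt hr.
have iiiE : (forall n,
     f n + \sum_(n - R <= k < n.+1 - r) f k * pprod h (n - k) / pprod g (n - k)
       = if n == 0%N then 1 else 0) <-> FPS f = A^-1.
  have coef_fA n :
      f n + \sum_(n - R <= k < n.+1 - r)
        f k * pprod h (n - k) / pprod g (n - k)
      = coefs (FPS f * A) n.
    (* The isolated f n is the term of the product with the constant term of A;
       the bounds on k select the degrees of the other terms of A. *)
    rewrite coefsM big_ord_recr subnn A0 mulr1 addrC; congr (_ + _).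
    rewrite (big_nat_widen _ _ n); last first.
      by rewrite leq_subLR -(prednK hr) addSn ltnS leq_addl.
    rewrite (big_nat_widenl _ 0) // big_mkord big_mkcond; apply: eq_bigr => k _.
    rewrite coefA subn_eq0 [(n <= k)%N]leqNgt ltn_ord /=.
    have -> : ((k < n.+1 - r) && (n - R <= k))%N = (r <= n - k <= R)%N.
      congr (_ && _); last by rewrite !leq_subLR addnC.
      by rewrite ltn_subRL ltnS leq_subRL ?[(k + r)%N]addnC // ltnW.
    by case: ifP; rewrite ?mulr0 // mulrA.
  split=> [fA|fA n]; last first.
    by rewrite coef_fA fA mulVr // coefs1; case: (n == 0%N).
  apply: (mulIr UA); rewrite mulVr //; apply/fpsP => n.
  by rewrite -coef_fA fA coefs1; case: (n == 0%N).
have ivE : (forall n, (0 < n)%N -> (-1) ^+ n *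
       \det (\matrix_(i < n, j < n)
         (if (j <= i)%N then f (i - j).+1
          else if nat_of_ord j == i.+1 then 1 else 0))
       = if (r <= n <= R)%N then HGratio h g n else 0) <-> FPS f = A^-1.
  apply: inv_coefs' => n n_gt0; rewrite coefA eqn0Ngt n_gt0 coefs_inv_det //=.
  suff -> : \matrix_(i < n, j < n) (if (j <= i)%N then f (i - j).+1
          else if nat_of_ord j == i.+1 then 1 else 0) =
     \matrix_(i < n, j < n)
         if (j <= i.+1)%N then f (i.+1 - j)%N else 0 by [].
  apply/matrixP => i j; rewrite !mxE.
  case: (ltngtP j i.+1) => [lt_ji|lt_ij|->]; last by rewrite ltnn subnn hf0.
    by rewrite -ltnS lt_ji subSn.
  by rewrite leqNgt (ltnW lt_ij).
have vE : (forall n, (0 < n)%N ->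
     f n = multinomial_sum (HGratio h g) r R n /\
     multinomial_sum (HGratio h g) r R n = composition_sum (HGratio h g) r R n)
    <-> FPS f = A^-1.
  apply: inv_coefs => n n_gt0; rewrite multinomial_sum_composition //.
  rewrite (coefs_inv_composition _ _ _ _ A) // => [|i /andP[i_gt0 _]].
    by split=> [[]|].
  by rewrite coefA eqn0Ngt i_gt0.
have viE : (forall n, (0 < n)%N ->
     multinomial_sum f 1 n n = composition_sum f 1 n n /\
     composition_sum f 1 n n = if (r <= n <= R)%N then HGratio h g n else 0)
    <-> FPS f = A^-1.
  apply: inv_coefs' => n n_gt0; rewrite multinomial_sum_composition //.
  rewrite (coefs_inv_composition _ _ _ _ (FPS f)) // => [|i i_bd].
    by rewrite coefA eqn0Ngt n_gt0; split=> [[]|].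
  by rewrite /= i_bd.
tfae.
- by move=> /iE /iiE.
- by move=> /iiE /iiiE.
- by move=> /iiiE /ivE.
- by move=> /ivE /vE.
- by move=> /vE /viE.
- by move=> /viE /iE.
Qed.
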